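(* Let $F$ be a normal functor on the category of compact metrizable spaces, and let $u=(u_X:C(X)\to C(FX))_X$ be a positive, monotonous, semiadditive functorial operator which is an extension operator. Then the operator $\tilde{\ }$ extends pseudometrics from $X$ to $FX$: for every compact metrizable space $X$ and every continuous pseudometric $p$ on $X$, the function $\tilde p: FX\times FX\to\mathbb{R}$ is a pseudometric on $FX$ whose restriction to $X\times X$ (with $X\subset FX$) equals $p$. Moreover: (i) if $u$ is continuous in the uniform topology, then so is the operator $\tilde{\ }$; (ii) if for every compact metrizable space $X$ the mapping $H_X=(F(pr_1),F(pr_2)):F(X\times X)\to FX\times FX$ is open, then for every compact metrizable space $X$ and every continuous pseudometric $d$ on $X$ the pseudometric $\tilde d$ on $FX$ is continuous.
   Context: $\mathrm{MComp}$ is the category of compact metrizable spaces and continuous maps. A functor $F:\mathrm{MComp}\to\mathrm{MComp}$ is normal if it is continuous (commutes with limits of inverse sequences), preserves injective maps and surjective maps, preserves intersections of closed subsets (for closed $Y\subset X$, $FY$ is identified with its image in $FX$ under $F$ of the inclusion) and preimages ($F(f^{-1}(B))=(Ff)^{-1}(FB)$ for continuous $f:X\to Y$ and closed $B\subset Y$), and preserves the one-point space and the empty space. By convention every normal functor is also bicommutative: call a commutative square $f:A\to B$, $g:A\to C$, $h:B\to D$, $k:C\to D$ with $hf=kg$ bicommutative if for all $b\in B$, $c\in C$ with $h(b)=k(c)$ there is $a\in A$ with $f(a)=b$ and $g(a)=c$; $F$ is bicommutative if it takes bicommutative squares to bicommutative squares. For a normal $F$, $X$ is regarded as a subspace of $FX$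 via the natural embedding sending $x$ to the unique point of $F(\{x\})\subset FX$. $C(X)$ is the set of continuous functions $X\to\mathbb{R}$. An operator $u:C(-)\to C(F(-))$ is a family of maps $u_X:C(X)\to C(FX)$, one for each compact metrizable $X$ (no continuity or linearity assumed). For a continuous map $i:Y\to X$, $i_*:C(X)\to C(Y)$ is $i_*(\phi)=\phi\circ i$. The operator $u$ is: functorial if $u_Y\circ i_*=(F(i))_*\circ u_X$ for every continuous map $i:Y\to X$; an extension operator if $u_X(\phi)|_X=\phi$; monotonous if $\phi\ge\psi$ implies $u_X(\phi)\ge u_X(\psi)$; semiadditive if $u_X(\phi+\psi)\le u_X(\phi)+u_X(\psi)$; positive if $\phi\ge 0$ implies $u_X(\phi)\ge 0$ (all for every $X$ and all $\phi,\psi\in C(X)$, inequalities being pointwise). It is continuous in the uniform topology if each $u_X$ is continuous with respect to the supremum norms. Let $pr_1,pr_2:X\times X\to X$ be the coordinate projections. For $a,b\in FX$ put $\langle a,b\rangle=\{c\in F(X\times X)\mid F(pr_1)(c)=a,\ F(pr_2)(c)=b\}$, which is nonempty by bicommutativity. For $p\in C(X\times X)$ define $\tilde p:FX\times FX\to\mathbb{R}$ by $\tilde p(a,b)=\inf\{u_{X\times X}(p)(c)\mid c\in\langle a,b\rangle\}$. The operator $\tilde{\ }$ is the assignment $p\mapsto\tilde p$; it is continuous in the uniform topology if for each $X$ it is continuous as a map from $C(X\times X)$ to the bounded real-valued functions on $FX\times FX$, both with the supremum norm. A pseudometric on $X$ is called continuous if it is continuous as a function on $X\times X$. *)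

(* Defs.v *)
From HB Require Import structures.
From mathcomp Require Import all_boot all_order all_algebra.
From mathcomp Require Import all_classical all_reals all_analysis.
Set Implicit Arguments.
Unset Strict Implicit.
Unset Printing Implicit Defensive.
Import Order.TTheory GRing.Theory Num.Theory.
Import numFieldNormedType.Exports.
Local Open Scope classical_set_scope.
Local Open Scope ring_scope.

Definition is_pseudometric (R : realType) (T : Type) (d : T * T -> R) : Prop :=
  [/\ forall x y, 0 <= d (x, y),
      forall x, d (x, x) = 0,
      forall x y, d (x, y) = d (y, x)
    & forall x y z, d (x, z) <= d (x, y) + d (y, z)].

Definition is_metric (R : realType) (T : Type) (d : T * T -> R) : Prop :=
  is_pseudometric d /\ forall x y, d (x, y) = 0 -> x = y.

Definition metrizable (R : realType) (X : topologicalType) : Prop :=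
  exists2 d : X * X -> R, is_metric d &
    forall x : X, nbhs x =
      filter_from [set e : R | 0 < e] (fun e => [set y | d (x, y) < e]).

(* [topologicalType] is not pointed, so the empty_space space is an object. *)
Record mcomp (R : realType) := MComp {
  mcomp_space :> topologicalType;
  mcomp_compact : compact [set: mcomp_space];
  mcomp_metrizable : metrizable R mcomp_space
}.

Section objects.
Context {R : realType}.
Implicit Types X Y : mcomp R.

Lemma mcomp_hausdorff X : hausdorff_space X.
Proof.
have [d [[dp0 d0 dsym dtri] dsep] nbhsd] := mcomp_metrizable X.
move=> p q pq; apply: dsep; apply/eqP; rewrite eq_le dp0 andbT leNgt.
apply/negP => D0; pose e := d (p, q) / 2.
have e0 : 0 < e by rewrite divr_gt0.
have np : nbhs p [set y | d (p, y) < e] by rewrite nbhsd; exists e.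
have nq : nbhs q [set y | d (q, y) < e] by rewrite nbhsd; exists e.
have [z [/= pz qz]] := pq _ _ np nq.
rewrite dsym in qz; have := le_lt_trans (dtri p z q) (ltrD pz qz).
by rewrite /e -splitr ltxx.
Qed.

Lemma closed_point X (x : X) : closed [set x].
Proof. by apply: compact_closed; [exact: mcomp_hausdorff|exact: compact_set1]. Qed.

Lemma prod_compact X Y : compact [set: X * Y].
Proof.
by rewrite -setXTT; apply: compact_setX; exact: mcomp_compact.
Qed.

Lemma prod_metrizable X Y : metrizable R (X * Y)%type.
Proof.
have [d [[dp d0 ds dt] dsep] nd] := mcomp_metrizable X.
have [g [[gp g0 gs gt] gsep] ng] := mcomp_metrizable Y.
exists (fun z => Num.max (d (z.1.1, z.2.1)) (g (z.1.2, z.2.2))) => /=.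
  split; first split=> /=.
  - by move=> x y; rewrite le_max dp.
  - by move=> x; rewrite d0 g0 maxxx.
  - by move=> x y; rewrite ds gs.
  - move=> x y z; rewrite ge_max; apply/andP; split.
      by rewrite (le_trans (dt _ y.1 _))// lerD// le_max lexx.
    by rewrite (le_trans (gt _ y.2 _))// lerD// le_max lexx orbT.
  move=> [x1 x2] [y1 y2] /= m0.
  have : Num.max (d (x1, y1)) (g (x2, y2)) <= 0 by rewrite m0.
  rewrite ge_max => /andP[h1 h2]; congr pair.
    by apply: dsep; apply/eqP; rewrite eq_le h1 dp.
  by apply: gsep; apply/eqP; rewrite eq_le h2 gp.
move=> [x y]; apply/seteqP; split => A /=.
  move=> [[B C] /=]; rewrite nd ng => -[[e e0 eB] [f f0 fC]] BCA.
  exists (Num.min e f); first by rewrite /= lt_min; apply/andP.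
  move=> [a b] /=; rewrite gt_max !lt_min => /andP[/andP[ae _] /andP[_ bf]].
  by apply: BCA; split; [exact: eB|exact: fC].
move=> [e /= e0 eA]; exists ([set a | d (x, a) < e], [set b | g (y, b) < e]).
  by rewrite /= nd ng; split; exists e.
by move=> [a b] [/= ae be]; apply: eA; rewrite /= gt_max ae.
Qed.

Definition mprod X Y : mcomp R :=
  MComp (@prod_compact X Y) (@prod_metrizable X Y).

Lemma sub_compact X (A : set X) : closed A -> compact [set: set_type A].
Proof.
move=> cA F FF _.
have cptA : compact A.
  exact: subclosed_compact cA (@mcomp_compact _ X) (@subsetT _ A).
have GA : (set_val @ F) A.
  by apply: (@filterS _ F _ setT) (filterT) => z _ /=; exact: set_valP.
have [x [Ax clx]] := cptA (set_val @ F) _ GA.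
exists (exist _ x (mem_set Ax)); split=> // B C FB [_ [[V oV <-] /= Vx VC]].
have FB' : (set_val @ F) (set_val @` B).
  by rewrite /fmap /=; apply: filterS FB; exact: preimage_image.
have [z [[y By <-] Vz]] := clx _ _ FB' (open_nbhs_nbhs (conj oV Vx)).
by exists y; split=> //; exact: VC.
Qed.

Lemma sub_metrizable X (A : set X) : metrizable R (set_type A).
Proof.
have [d [[dp d0 ds dt] dsep] nd] := mcomp_metrizable X.
exists (fun z => d (set_val z.1, set_val z.2)) => /=.
  split; first by split=> /= *.
  by move=> x y /= /dsep; exact: val_inj.
move=> x; apply/seteqP; split=> B /=.
  move=> [_ [[V oV <-] /= Vx VB]].
  have : nbhs (set_val x) V by exact: open_nbhs_nbhs.
  by rewrite nd => -[e e0 eV]; exists e => // y /= xy; apply: VB; exact: eV.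
move=> [e /= e0 eB].
have : nbhs (set_val x) [set y | d (set_val x, y) < e] by rewrite nd; exists e.
rewrite nbhsE => -[V [oV Vx] Ve]; exists (set_val @^-1` V).
by split=> //; [exists V|move=> y /Ve; exact: eB].
Qed.

Definition msub X (A : set X) (cA : closed A) : mcomp R :=
  MComp (sub_compact cA) (@sub_metrizable X A).

Definition incl X (A : set X) (cA : closed A) : continuousType (msub cA) X :=
  mkcts (@initial_continuous (set_type A) X set_val).

Lemma pr1_continuous X Y : continuous (fst : mprod X Y -> X).
Proof. by move=> z; exact: cvg_fst. Qed.
Lemma pr2_continuous X Y : continuous (snd : mprod X Y -> Y).
Proof. by move=> z; exact: cvg_snd. Qed.

Definition pr1 X Y : continuousType (mprod X Y) X := mkcts (@pr1_continuous X Y).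
Definition pr2 X Y : continuousType (mprod X Y) Y := mkcts (@pr2_continuous X Y).

Lemma addf_continuous X (phi psi : continuousType X R) : continuous (phi \+ psi).
Proof.
by move=> x; apply: cvgD; [exact: (@cts_fun _ _ phi)|exact: (@cts_fun _ _ psi)].
Qed.

Definition addf X (phi psi : continuousType X R) : continuousType X R :=
  mkcts (@addf_continuous X phi psi).

Definition compf X Y (phi : continuousType X R) (i : continuousType Y X) :
  continuousType Y R := phi \o i.

End objects.
Arguments closed_point {R X} x.

Record functor (R : realType) := Functor {
  Fobj :> mcomp R -> mcomp R;
  Fmap : forall X Y : mcomp R,
    continuousType X Y -> continuousType (Fobj X) (Fobj Y);
  Fmap_id : forall X : mcomp R, Fmap (@idfun X) =1 id;
  Fmap_comp : forall (X Y Z : mcomp R)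
    (g : continuousType Y Z) (f : continuousType X Y),
    Fmap (g \o f) =1 Fmap g \o Fmap f
}.

Section normality.
Context {R : realType} (F : functor R).

(* The universal property of the limit among compact metrizable spaces. *)
Definition invseq_limit (X : nat -> mcomp R)
    (bond : forall n, continuousType (X n.+1) (X n))
    (L : mcomp R) (pi : forall n, continuousType L (X n)) : Prop :=
  (forall n, bond n \o pi n.+1 =1 pi n) /\
  forall (Z : mcomp R) (q : forall n, continuousType Z (X n)),
    (forall n, bond n \o q n.+1 =1 q n) ->
    exists! h : continuousType Z L, forall n, pi n \o h =1 q n.

(* The image of [F A] in [F X], for a closed subset [A] of [X]. *)
Definition Fsub (X : mcomp R) (A : set X) (cA : closed A) : set (F X) :=
  range (Fmap F (incl cA)).

Definition one_point (X : mcomp R) : Prop := exists x : X, forall y : X, y = x.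
Definition empty_space (X : mcomp R) : Prop := forall x : X, False.

Definition bicommutative_square (A B C D : mcomp R)
    (f : continuousType A B) (g : continuousType A C)
    (h : continuousType B D) (k : continuousType C D) : Prop :=
  h \o f =1 k \o g /\
  forall b c, h b = k c -> exists a, f a = b /\ g a = c.

(* The last field is not part of the usual definition of a normal functor; every
   normal functor is assumed here to be bicommutative as well. *)
Record normal_functor : Prop := Normal {
  normal_continuous : forall (X : nat -> mcomp R)
      (bond : forall n, continuousType (X n.+1) (X n))
      (L : mcomp R) (pi : forall n, continuousType L (X n)),
    invseq_limit bond pi ->
    invseq_limit (fun n => Fmap F (bond n)) (fun n => Fmap F (pi n));
  normal_injective : forall (X Y : mcomp R) (f : continuousType X Y),
    injective f -> injective (Fmap F f);
  normal_surjective : forall (X Y : mcomp R) (f : continuousType X Y),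
    range f = setT -> range (Fmap F f) = setT;
  normal_bigcap : forall (X : mcomp R) (I : Type) (A : I -> set X)
      (cA : forall i, closed (A i)) (cI : closed (\bigcap_i A i)),
    Fsub cI = \bigcap_i Fsub (cA i);
  normal_preimage : forall (X Y : mcomp R) (f : continuousType X Y)
      (B : set Y) (cB : closed B) (cfB : closed (f @^-1` B)),
    Fsub cfB = Fmap F f @^-1` Fsub cB;
  normal_one_point : forall X : mcomp R, one_point X -> one_point (F X);
  normal_empty : forall X : mcomp R, empty_space X -> empty_space (F X);
  normal_bicommutative : forall (A B C D : mcomp R)
      (f : continuousType A B) (g : continuousType A C)
      (h : continuousType B D) (k : continuousType C D),
    bicommutative_square f g h k ->
    bicommutative_square (Fmap F f) (Fmap F g) (Fmap F h) (Fmap F k)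
}.

Lemma one_point_msub (X : mcomp R) (x : X) : one_point (msub (closed_point x)).
Proof.
exists (exist _ x (mem_set (erefl x))) => y; apply: val_inj.
exact: (set_valP y).
Qed.

Definition natural_embedding (nF : normal_functor) (X : mcomp R) (x : X) : F X :=
  Fmap F (incl (closed_point x))
    (projT1 (cid (normal_one_point nF (one_point_msub x)))).

Lemma natural_embeddingP (nF : normal_functor) (X : mcomp R) (x : X) :
  Fsub (closed_point x) = [set natural_embedding nF x].
Proof.
rewrite /natural_embedding; case: cid => a /= aP.
by apply/seteqP; split=> [_ [b _ <-]|_ ->] /=; [rewrite (aP b)|exists a].
Qed.

End normality.

Definition operator (R : realType) (F : functor R) : Type :=
  forall X : mcomp R, continuousType X R -> continuousType (F X) R.

Section operators.
Context {R : realType} (F : functor R) (u : operator F).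

Definition functorial_operator : Prop :=
  forall (X Y : mcomp R) (i : continuousType Y X) (phi : continuousType X R),
    u (compf phi i) = compf (u phi) (Fmap F i).

Definition extension_operator (nF : normal_functor F) : Prop :=
  forall (X : mcomp R) (phi : continuousType X R) (x : X),
    u phi (natural_embedding nF x) = phi x.

Definition monotonous_operator : Prop :=
  forall (X : mcomp R) (phi psi : continuousType X R),
    (forall x, psi x <= phi x) -> forall a, u psi a <= u phi a.

Definition semiadditive_operator : Prop :=
  forall (X : mcomp R) (phi psi : continuousType X R) (a : F X),
    u (addf phi psi) a <= u phi a + u psi a.

Definition positive_operator : Prop :=
  forall (X : mcomp R) (phi : continuousType X R),
    (forall x, 0 <= phi x) -> forall a, 0 <= u phi a.

(* [sup set0 = 0], so this is also correct on an empty_space [T]. *)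
Definition supnorm (T : Type) (f : T -> R) : R := sup (range (fun t => `|f t|)).

(* Continuity, for the supremum norms, of a map from [C(X)] to the bounded
   functions on [T].  Boundedness of the values is part of the definition because
   [supnorm f] is a junk value when [f] is unbounded. *)
Definition sup_continuous (X : mcomp R) (T : Type)
    (U : continuousType X R -> T -> R) : Prop :=
  (forall phi, bounded_fun (U phi)) /\
  forall (phi : continuousType X R) (e : R), 0 < e ->
    exists2 delta : R, 0 < delta & forall psi : continuousType X R,
      supnorm (psi \- phi) < delta -> supnorm (U psi \- U phi) < e.

Definition operator_sup_continuous : Prop :=
  forall X : mcomp R, sup_continuous (fun phi => u phi : F X -> R).

Definition fibre (X : mcomp R) (ab : F X * F X) : set (F (mprod X X)) :=
  [set c | Fmap F (pr1 X X) c = ab.1 /\ Fmap F (pr2 X X) c = ab.2].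

Definition tilde (X : mcomp R) (p : continuousType (mprod X X) R) :
    F X * F X -> R :=
  fun ab => inf [set u p c | c in fibre ab].

Definition tilde_sup_continuous : Prop :=
  forall X : mcomp R, sup_continuous (@tilde X).

Definition prH (X : mcomp R) (c : F (mprod X X)) : F X * F X :=
  (Fmap F (pr1 X X) c, Fmap F (pr2 X X) c).

End operators.

(* Main.v *)
(** The fibre <a, b> consists of the couplings of a and b.  Transposing a
coupling, gluing two of them along a common marginal (bicommutativity of the
square over X * X * X), and pushing a forward along the diagonal give symmetry,
the triangle inequality and reflexivity, exactly as for Kantorovich metrics.
Preservation of preimages and intersections leaves a single coupling of two
points of X, whence the restriction.  If couplings depend openly on their
marginals, a' close to a has a coupling with a close to the diagonal one, on
which u d vanishes; continuity elsewhere follows by the triangle inequality. *)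
Require Import Defs.
From mathcomp Require Import all_boot all_order all_algebra.
From mathcomp Require Import all_classical all_reals all_analysis.
From mathcomp Require Import lra.
Set Implicit Arguments.
Unset Strict Implicit.
Import Order.TTheory GRing.Theory Num.Theory.
Import numFieldNormedType.Exports.
Local Open Scope classical_set_scope.
Local Open Scope ring_scope.

(** Reduces continuity of a pseudometric anywhere to smallness near the diagonal. *)
Lemma pseudometric_dist_le (R : realType) (T : Type) (d : T * T -> R) x y x' y' :
  is_pseudometric d -> `|d (x, y) - d (x', y')| <= d (x, x') + d (y, y').
Proof.
move=> [_ _ ds dt]; rewrite ler_norml.
have := dt x x' y; have := dt x' y' y; have := dt x' x y'; have := dt x y y'.
rewrite (ds x' x) (ds y' y); lra.
Qed.

(** * Boundedness and basic maps on compact metrizable spaces *)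

Section compact_metrizable.
Context {R : realType}.
Implicit Types X Y Z : mcomp R.

Lemma bounded_fun_mcomp X (f : continuousType X R) : bounded_fun f.
Proof.
have cf : compact (range f).
  apply: continuous_compact; last exact: mcomp_compact.
  by apply: continuous_subspaceT; exact: (@cts_fun _ _ f).
have [M [Mr fM]] := compact_bounded cf.
by exists M; split=> // N /fM fN x _; apply: fN; exists x.
Qed.

Lemma cst_mcomp_continuous X (T : topologicalType) (t : T) :
  continuous (fun _ : X => t).
Proof. by move=> x; exact: cvg_cst. Qed.

Definition cstm X (T : topologicalType) (t : T) : continuousType X T :=
  mkcts (@cst_mcomp_continuous X T t).

Lemma pairm_continuous Z X Y (f : continuousType Z X) (g : continuousType Z Y) :
  continuous (fun z => (f z, g z) : mprod X Y).
Proof.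
by move=> z; apply: cvg_pair; [exact: (@cts_fun _ _ f)|exact: (@cts_fun _ _ g)].
Qed.

Definition pairm Z X Y (f : continuousType Z X) (g : continuousType Z Y) :
  continuousType Z (mprod X Y) := mkcts (@pairm_continuous Z X Y f g).

End compact_metrizable.
Arguments cstm {R} X {T} t.
Arguments pairm {R Z X Y} f g.

(** * Equations between images of maps under [F] *)

Section functors.
Context {R : realType} {F : functor R}.
Implicit Types X Y Z : mcomp R.

Lemma Fmap_ext X Y (f g : continuousType X Y) : f =1 g -> Fmap F f = Fmap F g.
Proof. by move=> fg; congr Fmap; apply/continuousEP. Qed.

Lemma Fmap_compE X Y Z (g : continuousType Y Z) (f : continuousType X Y)
    (h : continuousType X Z) a :
  (forall x, h x = g (f x)) -> Fmap F h a = Fmap F g (Fmap F f a).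
Proof. by move=> hE; rewrite (@Fmap_ext _ _ h (g \o f)) ?Fmap_comp. Qed.

Lemma Fmap_square (A B C D : mcomp R) (f : continuousType A B) (g : continuousType A C)
    (h : continuousType B D) (k : continuousType C D) a :
  (forall x, h (f x) = k (g x)) -> Fmap F h (Fmap F f a) = Fmap F k (Fmap F g a).
Proof. by move=> hk; rewrite -(Fmap_compE (h := k \o g))// Fmap_comp. Qed.

(** The closedness proof depends on the set and blocks rewriting; proof irrelevance makes its choice
    immaterial. *)
Lemma Fsub_eq X (A B : set X) (cA : closed A) (cB : closed B) :
  A = B -> Fsub cA = Fsub cB :> set (F X).
Proof. by move=> AB; subst B; rewrite (Prop_irrelevance cA cB). Qed.

Lemma fibre_diag X (a : F X) :
  fibre (a, a) (Fmap F (pairm (@idfun X) (@idfun X)) a).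
Proof.
by split=> /=; rewrite -(Fmap_compE (h := @idfun X)) ?Fmap_id.
Qed.

(** * Couplings under a normal functor *)

Section normal.
Hypothesis nF : normal_functor F.

Lemma normal_inhabited X : F X -> exists x : X, True.
Proof.
move=> a; apply: contrapT => nX; apply: (normal_empty nF _ a) => x.
by apply: nX; exists x.
Qed.

(** The projections of X * X complete the square of two maps to a one-point space; [F] keeps that
    space a point, so any [a] and [b] agree over it. *)
Lemma fibre_nonempty X (ab : F X * F X) : fibre ab !=set0.
Proof.
case: ab => a b; have [x _] := normal_inhabited a.
pose pt := msub (closed_point x).
have [s sP] := one_point_msub x; have [t tP] := normal_one_point nF (one_point_msub x).
have sq : bicommutative_square (pr1 X X) (pr2 X X)
    (cstm X (s : pt)) (cstm X (s : pt)).
  by split=> // y z _; exists (y, z).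
have [_ /(_ a b)] := normal_bicommutative nF sq.
by rewrite (tP (Fmap F _ a)) (tP (Fmap F _ b)) => /(_ erefl)[c cab]; exists c.
Qed.

(** The singleton of (x, y) is the intersection of the preimages of x and y under the projections,
    so [c] lies in the one-point image of [F] of that singleton. *)
Lemma fibre_natural_embedding X (x y : X) (c : F (mprod X X)) :
  fibre (natural_embedding nF x, natural_embedding nF y) c ->
  c = natural_embedding nF ((x, y) : mprod X X).
Proof.
move=> [/= cx cy].
have cpre (f : continuousType (mprod X X) X) z : closed (f @^-1` [set z]).
  by move: (closed_point z); apply: closed_comp => w _; exact: (@cts_fun _ _ f).
pose A (b : bool) := if b then pr1 X X @^-1` [set x] else pr2 X X @^-1` [set y].
have cA b : closed (A b) by case: b; exact: cpre.
have AE : \bigcap_b A b = [set ((x, y) : mprod X X)].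
  apply/seteqP; split=> [[x' y'] h|_ ->].
    have xE : x' = x := h true I; have yE : y' = y := h false I.
    by rewrite xE yE.
  by case.
have cI : closed (\bigcap_b A b) by rewrite AE; exact: closed_point.
have : Fsub cI c.
  rewrite (normal_bigcap nF cA) => -[|] _ /=.
    by rewrite (normal_preimage nF (closed_point x)) natural_embeddingP.
  by rewrite (normal_preimage nF (closed_point y)) natural_embeddingP.
by rewrite (Fsub_eq cI (closed_point ((x, y) : mprod X X)) AE) natural_embeddingP.
Qed.

Lemma fibre_glue X (a b e : F X) (c c' : F (mprod X X)) :
  fibre (a, b) c -> fibre (b, e) c' ->
  exists w : F (mprod (mprod X X) X),
    [/\ Fmap F (pr1 _ _) w = c,
        Fmap F (pairm (pr2 X X \o pr1 (mprod X X) X) (pr2 (mprod X X) X)) w = c' &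
        fibre (a, e) (Fmap F (pairm (pr1 X X \o pr1 (mprod X X) X) (pr2 (mprod X X) X)) w)].
Proof.
move=> [/= ca cb] [/= cb' ce].
(* X * X * X is the pullback of two copies of X * X over the shared middle coordinate. *)
have sq : bicommutative_square (pr1 (mprod X X) X)
    (pairm (pr2 X X \o pr1 (mprod X X) X) (pr2 (mprod X X) X)) (pr2 X X) (pr1 X X).
  split=> // -[x y] [y' z] yy'; have {yy'}-> : y = y' := yy'.
  by exists (x, y', z).
have [_ /(_ c c')] := normal_bicommutative nF sq.
rewrite cb cb' => /(_ erefl)[w [w1 w2]]; exists w; split=> //; split=> /=.
  by rewrite -ca -w1; exact: Fmap_square.
by rewrite -ce -w2; exact: Fmap_square.
Qed.

End normal.

(** * The infimum over couplings and its dependence on p *)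

Section tilde.
Context {u : operator F}.

Lemma tilde_le X (p : continuousType (mprod X X) R) ab c :
  fibre ab c -> tilde u p ab <= u p c.
Proof.
(* [inf] is a lower bound only of sets bounded below; compactness bounds [u p]. *)
move=> abc; apply: ge_inf; last by exists c.
have /= := bounded_fun_has_lbound (bounded_fun_mcomp (u p)).
by move=> [m um]; exists m => _ [c' _ <-]; apply: um; exists c'.
Qed.

Hypothesis nF : normal_functor F.

(** Nonempty fibres exclude the default value of [inf] on the empty set. *)
Lemma le_tilde X (p : continuousType (mprod X X) R) ab r :
  (forall c, fibre ab c -> r <= u p c) -> r <= tilde u p ab.
Proof.
move=> rp; apply: lb_le_inf => [|_ [c abc <-]]; last exact: rp.
by have [c abc] := fibre_nonempty nF ab; exists (u p c); exists c.
Qed.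

Lemma tilde_natural_embedding X (p : continuousType (mprod X X) R) x y :
  extension_operator u nF ->
  tilde u p (natural_embedding nF x, natural_embedding nF y) = p (x, y).
Proof.
move=> uE; apply/eqP; rewrite eq_le; apply/andP; split; last first.
  by apply: le_tilde => c /fibre_natural_embedding->; rewrite uE.
have [c cxy] := fibre_nonempty nF (natural_embedding nF x, natural_embedding nF y).
by rewrite (le_trans (tilde_le p cxy))// (fibre_natural_embedding cxy) uE.
Qed.

(* A constant factors through a one-point space P, and F P is reduced to the
   image of P under the natural embedding. *)
Lemma operator_cst X (r : R) a :
  functorial_operator u -> extension_operator u nF -> u (cstm X r) a = r.
Proof.
move=> uF uE; have [x _] := normal_inhabited nF a.
pose pt := msub (closed_point x).
have [s _] := one_point_msub x; have [t tP] := normal_one_point nF (one_point_msub x).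
have -> : cstm X r = compf (cstm pt r) (cstm X s) by exact/continuousEP.
by rewrite uF /= (tP (Fmap F _ a)) -(tP (natural_embedding nF s)) uE.
Qed.

Lemma tilde_ler_add X (p q : continuousType (mprod X X) R) (r : R) ab :
  (forall c, u p c <= u q c + r) -> tilde u p ab <= tilde u q ab + r.
Proof.
move=> pq; rewrite -lerBlDr; apply: le_tilde => c abc.
by rewrite lerBlDr (le_trans (tilde_le p abc)).
Qed.

Lemma tilde_dist_le X (p q : continuousType (mprod X X) R) (r : R) ab :
  (forall c, `|u p c - u q c| <= r) -> `|tilde u p ab - tilde u q ab| <= r.
Proof.
move=> pq.
rewrite ler_norml lerNl opprB !lerBlDl; apply/andP; split.
  by apply: tilde_ler_add => c; have := pq c; rewrite ler_norml; lra.
by apply: tilde_ler_add => c; have := pq c; rewrite ler_norml; lra.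
Qed.

Lemma tilde_bounded X (p : continuousType (mprod X X) R) : bounded_fun (tilde u p).
Proof.
have [N [Nr Nu]] := bounded_fun_mcomp (u p).
exists N; split=> // M /Nu uM ab _ /=.
have [c abc] := fibre_nonempty nF ab.
rewrite ler_norml; apply/andP; split.
  by apply: le_tilde => c' _; have := uM c' I; rewrite /= ler_norml => /andP[].
by apply: le_trans (tilde_le p abc) _; have := uM c I; rewrite /= ler_norml => /andP[].
Qed.

(** Infima over the same fibre differ by at most the sup distance of [u p] and [u q], so the [delta]
    of [u] on X * X serves again. *)
Lemma tilde_sup_continuity :
  operator_sup_continuous u -> tilde_sup_continuous u.
Proof.
move=> cu X; split=> [p|p e e0]; first exact: tilde_bounded.
have [[ab0 _]|nab] := pselect (exists ab : F X * F X, True); last first.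
  (* With [F X] empty, [supnorm] is [sup set0], that is 0, and any [delta] will do. *)
  exists 1 => // q _; rewrite /supnorm [X in sup X](_ : _ = set0) ?sup0//.
  by rewrite -subset0 => r [ab _ _]; apply: nab; exists ab.
have [_ /(_ p e e0)[delta delta0 dP]] := cu (mprod X X).
exists delta => // q /dP; apply: le_lt_trans.
have ub c : `|u q c - u p c| <= supnorm (u q \- u p).
  apply: ub_le_sup; last by exists c.
  have : bounded_fun (u q \- u p : F (mprod X X) -> R^o).
    exact: bounded_funD (bounded_fun_mcomp (u q))
      (bounded_funN (bounded_fun_mcomp (u p))).
  (* [bounded_fun] yields bounds only strictly above [M]. *)
  move=> [M [_ /(_ (M + 1))]]; rewrite ltrDl ltr01 => /(_ erefl) bM.
  by exists (M + 1) => _ [c' _ <-]; exact: bM.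
apply: ge_sup => [|_ [ab _ <-]]; last exact: tilde_dist_le.
by exists `|tilde u q ab0 - tilde u p ab0|; exists ab0.
Qed.

(** * Pseudometric axioms and continuity from functoriality of [u] *)

Hypothesis uF : functorial_operator u.

Lemma operator_compf X Y (p : continuousType Y R) (f : continuousType X Y)
    (q : continuousType X R) a :
  (forall x, q x = p (f x)) -> u q a = u p (Fmap F f a).
Proof.
by move=> qp; have -> : q = compf p f by [exact/continuousEP]; rewrite uF.
Qed.

(** Pulled back along the diagonal, [p] is the constant 0. *)
Lemma operator_diag X (p : continuousType (mprod X X) R) (a : F X) :
  extension_operator u nF -> (forall x, p (x, x) = 0) ->
  u p (Fmap F (pairm (@idfun X) (@idfun X)) a) = 0.
Proof.
move=> uE p0; rewrite -(operator_compf (q := cstm X (0 : R)) a) ?operator_cst//.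
by move=> x; rewrite /= p0.
Qed.

Lemma tilde_sym_le X (p : continuousType (mprod X X) R) a b :
  (forall x y, p (x, y) = p (y, x)) -> tilde u p (a, b) <= tilde u p (b, a).
Proof.
move=> ps; apply: le_tilde => c [/= cb ca].
pose swap := pairm (pr2 X X) (pr1 X X).
rewrite (operator_compf (p := p) (f := swap)) => [|[x y]]; last exact: ps.
apply: tilde_le; split=> /=.
  by rewrite -ca -(Fmap_compE (h := pr2 X X)).
by rewrite -cb -(Fmap_compE (h := pr1 X X)).
Qed.

Lemma tilde_pseudometric X (p : continuousType (mprod X X) R) :
  positive_operator u -> monotonous_operator u -> semiadditive_operator u ->
  extension_operator u nF -> is_pseudometric p -> is_pseudometric (tilde u p).
Proof.
move=> u_pos u_mono u_sub uE [p0 pd ps pt].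
have tp0 a b : 0 <= tilde u p (a, b).
  by apply: le_tilde => c _; apply: u_pos => -[x y]; exact: p0.
split=> // [a|a b|a b e].
- by apply/eqP; rewrite eq_le tp0 andbT -(operator_diag a uE pd) tilde_le//; exact: fibre_diag.
- by apply/eqP; rewrite eq_le !tilde_sym_le.
(* Both infima on the right are replaced by values at arbitrary couplings [c] and [c']. *)
rewrite -lerBlDr; apply: le_tilde => c abc; rewrite lerBlDr -lerBlDl.
apply: le_tilde => c' bec; rewrite lerBlDl.
have [w [wc wc' wae]] := fibre_glue nF abc bec.
apply: le_trans (tilde_le p wae) _; rewrite -wc -wc'.
(* All three terms become values at [w] of functions on X * X * X, where the triangle inequality for
   [p] holds pointwise. *)
set p13 := pairm _ _; set p23 := pairm _ _.
have -> : u p (Fmap F p13 w) = u (compf p p13) w by rewrite uF.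
have -> : u p (Fmap F (pr1 _ _) w) = u (compf p (pr1 _ _)) w by rewrite uF.
have -> : u p (Fmap F p23 w) = u (compf p p23) w by rewrite uF.
by apply: le_trans (u_sub _ _ _ _); apply: u_mono => -[[x y] z]; exact: pt.
Qed.

Lemma tilde_continuous X (d : continuousType (mprod X X) R) :
  extension_operator u nF ->
  (forall U : set (F (mprod X X)), open U -> open (@prH R F X @` U)) ->
  (forall x, d (x, x) = 0) -> is_pseudometric (tilde u d) ->
  continuous (tilde u d).
Proof.
move=> uE oH d0 td.
have near_diag (a : F X) (e : R) : 0 < e -> \forall a' \near a, tilde u d (a, a') < e.
  move=> e0; pose U := u d @^-1` [set r | r < e].
  have oU : open U.
    by apply: open_comp; [move=> c _; exact: (@cts_fun _ _ (u d))|exact: open_lt].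
  have Haa : (@prH R F X @` U) (a, a).
    exists (Fmap F (pairm (@idfun X) (@idfun X)) a); first by rewrite /U /= operator_diag.
    by have [ca cb] := fibre_diag a; rewrite /prH ca cb.
  (* Openness gives a box around (a, a) whose pairs all have a coupling in [U]; only its slice
     through [a] is used. *)
  have [[A B] [/= Aa Ba] ABH] := open_nbhs_nbhs (conj (oH U oU) Haa).
  apply: filterS Ba => a' Ba'.
  have [|c cU [ca cb]] := ABH (a, a'); first by split=> //; exact: nbhs_singleton Aa.
  by apply: le_lt_trans (tilde_le d _) cU; split.
move=> [a b]; apply/cvgrPdist_lt => e e0.
have e20 : 0 < e / 2 by rewrite divr_gt0.
exists ([set a' | tilde u d (a, a') < e / 2], [set b' | tilde u d (b, b') < e / 2]).
  by split; exact: near_diag.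
move=> [a' b'] [/= aa' bb']; rewrite (splitr e).
exact: le_lt_trans (pseudometric_dist_le _ _ _ _ td) (ltrD aa' bb').
Qed.

End tilde.

End functors.

Theorem theorem1 (R : realType) (F : functor R) (nF : normal_functor F) (u : operator F)
    (u_positive : positive_operator u) (u_monotonous : monotonous_operator u)
    (u_semiadditive : semiadditive_operator u) (u_functorial : functorial_operator u)
    (u_extension : extension_operator u nF) :
  (forall (X : mcomp R) (p : continuousType (mprod X X) R),
     is_pseudometric p ->
     is_pseudometric (tilde u p) /\
     forall x y : X,
       tilde u p (natural_embedding nF x, natural_embedding nF y) = p (x, y)) /\
  (operator_sup_continuous u -> tilde_sup_continuous u) /\
  ((forall (X : mcomp R) (U : set (F (mprod X X))), open U ->
      open (@prH R F X @` U)) ->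
   forall (X : mcomp R) (d : continuousType (mprod X X) R),
     is_pseudometric d -> continuous (tilde u d)).
Proof.
split; last split.
- move=> X p pp; split=> [|x y]; last exact: tilde_natural_embedding.
  exact: tilde_pseudometric pp.
- exact: tilde_sup_continuity.
- move=> oH X d pd; apply: tilde_continuous (oH X) _ _ => //; first by case: pd.
  exact: tilde_pseudometric pd.
Qed.
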